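(* Let $\mu,u\colon\mathbb{R}\to\mathbb{R}$ be two non-constant smooth functions, and consider on the space $\mathbb{R}^3$ of edge lengths $(l_1,l_2,l_3)$ of decorated ideal triangles the differential $1$-form $\omega=\sum_{i=1}^3\mu(x_i)\,du(l_i)$. Up to an overall scale, the closed $1$-forms of this type are exactly the forms $$\omega_h=\sum_{i=1}^3\Big(\int^{x_i}e^{ht^2}\,dt\Big)\,d\Big(\int^{l_i}e^{-he^{-t}}\,dt\Big),\qquad h\in\mathbb{R}.$$ That is, $\omega$ is closed if and only if there are $h\in\mathbb{R}$, a constant $c\neq0$ and an antiderivative $M_h$ of the function $t\mapsto e^{ht^2}$ such that $\omega=c\sum_{i=1}^3 M_h(x_i)\,e^{-he^{-l_i}}\,dl_i$.
   Context: A decorated ideal triangle is an ideal triangle in $\mathbb{H}^2$ each of whose ideal vertices $v$ is equipped with a horodisk $B_v$ centered at $v$. Its generalized angle at $v$ is the length of the part of $\partial B_v$ lying in the cusp region bounded by the two edges at $v$, and the generalized length of an edge with ideal vertices $u,v$ is the signed hyperbolic distance along the edge between its intersections with $\partial B_u$ and $\partial B_v$ (zero or negative if $B_u\cap B_v\ne\emptyset$). Any $(l_1,l_2,l_3)\in\mathbb{R}^3$ is the triple of edge lengths of a decorated ideal triangle, and the generalized angle $\theta_i$ opposite the $i$-th edge is $\theta_i=e^{(l_i-l_j-l_k)/2}$, $\{i,j,k\}=\{1,2,3\}$. Put $x_i=\frac{\theta_j+\theta_k-\theta_i}{2}$, viewed as a function of $(l_1,l_2,l_3)$. The symbol $\int^{x}f(t)\,dt$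 denotes an indefinite integral (antiderivative) of $f$ evaluated at $x$; the same antiderivative is used for $i=1,2,3$. *)

(* Defs.v *)
From HB Require Import structures.
From mathcomp Require Import all_boot all_order all_algebra.
From mathcomp Require Import all_classical all_reals all_analysis.

Set Implicit Arguments.
Unset Strict Implicit.
Unset Printing Implicit Defensive.

Import Order.TTheory GRing.Theory Num.Theory.
Import numFieldNormedType.Exports.

Local Open Scope ring_scope.

Definition smooth (R : realType) (f : R -> R) : Prop :=
  forall (n : nat) (t : R), derivable (derive1n n f) t 1.

Definition nonconstant (R : realType) (f : R -> R) : Prop :=
  ~ exists c : R, forall t : R, f t = c.

Definition antiderivative (R : realType) (f F : R -> R) : Prop :=
  forall t : R, is_derive t (1 : R) F (f t).

(* Indices live in 'I_3 with its ring structure of integers modulo 3, so that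
   {i, i + 1, i + 2} = {0, 1, 2} for every i : 'I_3.  The formulas below are
   symmetric in i + 1 and i + 2. *)
Definition gen_angle (R : realType) (i : 'I_3) (l : 'rV[R]_3) : R :=
  expR ((l 0 i - l 0 (i + 1) - l 0 (i + 2)) / 2).

Definition xcoord (R : realType) (i : 'I_3) (l : 'rV[R]_3) : R :=
  (gen_angle (i + 1) l + gen_angle (i + 2) l - gen_angle i l) / 2.

(* A 1-form on R^3 sends a point and a tangent vector to a number; forms are
   only built here as combinations of differentials, so linearity in the second
   argument is automatic. *)
Definition one_form (R : realType) : Type := 'rV[R]_3 -> 'rV[R]_3 -> R.

(* (d w)(v1, v2) = v1(w(v2)) - v2(w(v1)) - w([v1, v2]), evaluated on constant
   vector fields, for which the bracket vanishes. *)
Definition exterior_derivative (R : realType) (w : one_form R)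
    (l v1 v2 : 'rV[R]_3) : R :=
  'D_v1 (fun q : 'rV[R]_3 => w q v2 : R^o) l -
  'D_v2 (fun q : 'rV[R]_3 => w q v1 : R^o) l.

Definition closed_form (R : realType) (w : one_form R) : Prop :=
  forall l v1 v2 : 'rV[R]_3, exterior_derivative w l v1 v2 = 0.

Definition omega (R : realType) (mu u : R -> R) : one_form R :=
  fun l v => \sum_(i < 3)
    mu (xcoord i l) * 'd (fun q : 'rV[R]_3 => u (q 0 i) : R^o) l v.

Definition omega_h (R : realType) (h : R) (M : R -> R) : one_form R :=
  fun l v => \sum_(i < 3)
    M (xcoord i l) * expR (- h * expR (- l 0 i)) *
    'd (fun q : 'rV[R]_3 => q 0 i : R^o) l v.

(* Main.v *)
Require Import Defs.
From HB Require Import structures.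
From mathcomp Require Import all_boot all_order all_algebra.
From mathcomp Require Import all_classical all_reals all_analysis.
From mathcomp Require Import ring lra.

Set Implicit Arguments.
Unset Strict Implicit.
Unset Printing Implicit Defensive.

Import Order.TTheory GRing.Theory Num.Theory.
Import numFieldNormedType.Exports.

Local Open Scope ring_scope.

(** The generalized angles satisfy theta_j theta_k = e^(-l_i) and
    theta_j = x_k + x_i, so e^(-l_i) = (x_i + x_j)(x_i + x_k), and
    (x_0, x_1, x_2) may be any triple with positive pairwise sums
    ([expRN_coord], [xcoord_surj]). Differentiating gives dx_i/dl_j = x_k / 2,
    which is symmetric in i and j ([is_derive_xcoord]); hence the
    coefficient of dl_j ^ dl_i in the exterior derivative of [omega mu u] is
    x_k / 2 times mu'(x_i) u'(l_i) - mu'(x_j) u'(l_j), up to sign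
    ([exterior_derivative_coord_form]).

    For mu' = e^(h t^2) and u' = e^(- h e^(-t)), the product mu'(x_i) u'(l_i) is
    exp(- h (x_0 x_1 + x_1 x_2 + x_2 x_0)) for every i, so the form is closed
    ([closed_coord_form_gauss]).

    Conversely, put f = mu' and g(s) = u'(- ln s). Closedness becomes
    f(x) g(s + x^2 - y^2) = f(y) g(s) for y <= 0, x > - y and s > 0
    ([closed_coord_form_functional_eq]). Since f and g do not vanish
    identically, they vanish nowhere ([gauss_functional_eq_neq0]). Taking y = 0,
    the ratio g(s + d) / g(s) depends on d alone, so g is a multiple of an
    exponential e^(- h s), and then f is a multiple of e^(h x^2)
    ([gauss_functional_eq]).

    That each [omega_h] is of the type considered requires a global
    antiderivative U of e^(- h e^(-t)) ([continuous_antiderivative]) and the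
    smoothness of the functions involved ([smooth_poly_exp]). *)

(** * The exterior derivative of the forms sum_i A(x_i) B(l_i) dl_i *)

Lemma ord3_shift (i : 'I_3) :
  [/\ i + 1 + 1 = i + 2, i + 1 + 2 = i, i + 2 + 1 = i & i + 2 + 2 = i + 1].
Proof.
by split; case: i => -[|[|[|//]]] lti; apply/val_inj.
Qed.

Lemma ord3D :
  ((((1 + 1)%R = 2%R :> 'I_3) * ((1 + 2)%R = 0%R :> 'I_3)) *
   (((2 + 1)%R = 0%R :> 'I_3) * ((2 + 2)%R = 1%R :> 'I_3)))%type.
Proof. by do !split; apply/val_inj. Qed.

(** The difference quotient of [F] at [l] along [v] is the difference quotient
    at 0 of its restriction to the line through [l], so directional derivatives
    on R^3 reduce to the calculus of functions of one variable. *)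
Lemma is_derive_line (R : realType) (F : 'rV[R]_3 -> R)
    (l v : 'rV[R]_3) (D : R) :
  is_derive (0 : R) (1 : R) (fun h => F (h *: v + l)) D ->
  is_derive l v (F : 'rV[R]_3 -> R^o) D.
Proof.
have E : (fun h : R => h^-1 *: (((fun h => F (h *: v + l)) \o shift 0) (h *: 1)
            - F (0 *: v + l))) =
         (fun h : R => h^-1 *: (((F : _ -> R^o) \o shift l) (h *: v) - F l)).
  apply/funext => h /=.
  by rewrite addr0 scale0r add0r /GRing.scale /= mulr1.
case=> dF <-; split.
  by move: dF; rewrite /derivable E.
by rewrite /derive E.
Qed.

Lemma is_derive_coord (R : realType) (l v : 'rV[R]_3) (i : 'I_3) :
  is_derive (0 : R) (1 : R) (fun h => (h *: v + l) 0 i) (v 0 i).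
Proof.
have -> : (fun h : R => (h *: v + l) 0 i) = (fun h => h * v 0 i + l 0 i).
  by apply/funext => h; rewrite !mxE.
by apply: is_derive_eq; rewrite /GRing.scale /= mulr0 mulr1 add0r addr0.
Qed.

Lemma is_derive_gen_angle (R : realType) (l v : 'rV[R]_3) (i : 'I_3) :
  is_derive (0 : R) (1 : R) (fun h => gen_angle i (h *: v + l))
   (gen_angle i l * ((v 0 i - v 0 (i + 1) - v 0 (i + 2)) / 2)).
Proof.
have := is_derive_coord l v i; have := is_derive_coord l v (i + 1).
have := is_derive_coord l v (i + 2) => d2 d1 d0.
rewrite /gen_angle.
apply: is_derive_eq.
rewrite scale0r add0r /GRing.scale /=.
by field.
Qed.

(** The symmetry behind closedness: in dx_i the coefficient of dl_j is x_k / 2,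
    where {i, j, k} = {0, 1, 2}, and it stays the same when i and j are
    exchanged. The coefficient of dl_i itself cancels in exterior
    derivatives. *)
Lemma is_derive_xcoord (R : realType) (l v : 'rV[R]_3) (i : 'I_3) :
  is_derive (0 : R) (1 : R) (fun h => xcoord i (h *: v + l))
   ((xcoord (i + 2) l * v 0 (i + 1) + xcoord (i + 1) l * v 0 (i + 2)
     - (gen_angle i l + gen_angle (i + 1) l + gen_angle (i + 2) l) / 2
       * v 0 i) / 2).
Proof.
have := is_derive_gen_angle l v i; have := is_derive_gen_angle l v (i + 1).
have := is_derive_gen_angle l v (i + 2) => d2 d1 d0.
rewrite /xcoord.
have [e11 e12 e21 e22] := ord3_shift i.
rewrite e11 e12 e21 e22 in d1 d2 *.
apply: is_derive_eq.
rewrite /GRing.scale /=.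
by field.
Qed.

Lemma diff_pull_coord (R : realType) (B B' : R -> R) (l v : 'rV[R]_3)
    (i : 'I_3) :
  is_derive (l 0 i) (1 : R) B (B' (l 0 i)) ->
  'd (fun q : 'rV[R]_3 => B (q 0 i) : R^o) l v = B' (l 0 i) * v 0 i.
Proof.
move=> dB.
have dc : differentiable (fun q : 'rV[R]_3 => q 0 i : R^o) l.
  exact: differentiable_coord.
have dBc : differentiable (B : R -> R^o) (l 0 i).
  by apply/derivable1_diffP; case: dB.
rewrite -deriveE; last first.
  exact: (@differentiable_comp _ _ _ _ (fun q : 'rV[R]_3 => q 0 i : R^o)
    (B : R^o -> R^o)).
apply: (@derive_val _ _ _ _ _ _ _ (is_derive_line _)).
have d1 := is_derive_coord l v i.
have E : (0 *: v + l) 0 i = l 0 i by rewrite scale0r add0r.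
have := @is_derive1_comp R B (fun h => (h *: v + l) 0 i) 0 (B' (l 0 i)) (v 0 i).
rewrite /= E => /(_ dB d1).
by [].
Qed.

(** Both [omega] and [omega_h] are forms sum_i A(x_i) B(l_i) dl_i; working with
    this common shape removes the Frechet differentials. *)
Definition coord_form (R : realType) (A B : R -> R) : one_form R :=
  fun l v => \sum_(i < 3) A (xcoord i l) * B (l 0 i) * v 0 i.

Lemma sum_ord3 (R : realType) (F : 'I_3 -> R) :
  \sum_(i < 3) F i = F 0 + F 1 + F 2.
Proof.
rewrite !big_ord_recl big_ord0 addr0 addrA.
by congr (_ + _ + _); congr F; apply/val_inj.
Qed.

Lemma omegaE (R : realType) (mu u u' : R -> R) (l v : 'rV[R]_3) :
  antiderivative u' u -> omega mu u l v = coord_form mu u' l v.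
Proof.
move=> du; apply: eq_bigr => i _.
by rewrite (diff_pull_coord v (du (l 0 i))) mulrA.
Qed.

Lemma omega_hE (R : realType) (h : R) (M : R -> R) (l v : 'rV[R]_3) :
  omega_h h M l v = coord_form M (fun t => expR (- h * expR (- t))) l v.
Proof.
apply: eq_bigr => i _; congr (_ * _).
by rewrite (@diff_pull_coord R id (fun=> 1)) ?mul1r.
Qed.

Lemma derive_coord_form (R : realType) (A A' B B' : R -> R) (l v w : 'rV[R]_3) :
  antiderivative A' A -> antiderivative B' B ->
  'D_v (fun q => coord_form A B q w : R^o) l =
  \sum_(i < 3) (A' (xcoord i l) * B (l 0 i) *
    ((xcoord (i + 2) l * v 0 (i + 1) + xcoord (i + 1) l * v 0 (i + 2)
     - (gen_angle i l + gen_angle (i + 1) l + gen_angle (i + 2) l) / 2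
       * v 0 i) / 2)
    + A (xcoord i l) * B' (l 0 i) * v 0 i) * w 0 i.
Proof.
move=> dA dB; apply: (@derive_val _ _ _ _ _ _ _ (is_derive_line _)).
rewrite /coord_form.
have -> : (fun h : R => \sum_(i < 3) A (xcoord i (h *: v + l)) *
              B ((h *: v + l) 0 i) * w 0 i) =
   \sum_(i < 3) (fun h : R => A (xcoord i (h *: v + l)) *
              B ((h *: v + l) 0 i) * w 0 i).
  by apply/funext => h; rewrite fct_sumE.
apply: is_derive_sum => i.
have E : 0 *: v + l = l by rewrite scale0r add0r.
have d1 := is_derive_coord l v i.
have d2 := is_derive_xcoord l v i.
have dA1 := dA (xcoord i (0 *: v + l)).
have dB1 := dB ((0 *: v + l) 0 i).
have c1 := @is_derive1_comp R A (fun h => xcoord i (h *: v + l)) 0 _ _ dA1 d2.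
have c2 := @is_derive1_comp R B (fun h => (h *: v + l) 0 i) 0 _ _ dB1 d1.
apply: is_derive_eq.
rewrite E /GRing.scale /=.
ring.
Qed.

(** The terms A(x_i) B'(l_i) dl_i ^ dl_i vanish, and by the symmetry of
    dx_i/dl_j the two remaining terms in dl_i ^ dl_j combine with common factor
    x_k / 2. So closedness amounts to A'(x_i) B(l_i) = A'(x_j) B(l_j) wherever
    x_k is nonzero. *)
Lemma exterior_derivative_coord_form (R : realType) (A A' B B' : R -> R)
    (l v w : 'rV[R]_3) :
  antiderivative A' A -> antiderivative B' B ->
  exterior_derivative (coord_form A B) l v w =
  \sum_(k < 3) xcoord k l / 2 *
    (A' (xcoord (k + 1) l) * B (l 0 (k + 1)) -
     A' (xcoord (k + 2) l) * B (l 0 (k + 2))) *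
    (v 0 (k + 2) * w 0 (k + 1) - v 0 (k + 1) * w 0 (k + 2)).
Proof.
move=> dA dB; rewrite /exterior_derivative !(derive_coord_form _ _ _ dA dB).
rewrite !sum_ord3 !(add0r, ord3D).
by field.
Qed.

(** * Closedness in the coordinates x_i *)

(** The horocyclic relation theta_j theta_k = e^(-l_i), combined with
    theta_j = x_k + x_i. *)
Lemma expRN_coord (R : realType) (l : 'rV[R]_3) (i : 'I_3) :
  expR (- l 0 i) =
  (xcoord i l + xcoord (i + 1) l) * (xcoord i l + xcoord (i + 2) l).
Proof.
have [e11 e12 e21 e22] := ord3_shift i.
transitivity (gen_angle (i + 2) l * gen_angle (i + 1) l).
  rewrite /gen_angle e11 e12 e21 e22 -expRD; congr expR.
  by field.
rewrite /xcoord e11 e12 e21 e22.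
by field.
Qed.

(** Here A'(x_i) B(l_i) is a times the exponential of h times
    x_i^2 - (x_i + x_j)(x_i + x_k) = - (x_i x_j + x_j x_k + x_k x_i), which is
    symmetric in the three indices. *)
Lemma closed_coord_form_gauss (R : realType) (h a : R) (A : R -> R) :
  antiderivative (fun t => a * expR (h * t ^+ 2)) A ->
  closed_form (coord_form A (fun t => expR (- h * expR (- t)))).
Proof.
move=> dA l v w.
have dB : antiderivative
    (fun t : R => h * expR (- t) * expR (- h * expR (- t)))
    (fun t => expR (- h * expR (- t))).
  move=> t; apply: is_derive_eq; rewrite /GRing.scale /=; ring.
rewrite (exterior_derivative_coord_form _ _ _ dA dB).
rewrite big1// => k _.
have sym i : a * expR (h * xcoord i l ^+ 2) * expR (- h * expR (- l 0 i)) =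
   a * expR (- h * (xcoord i l * xcoord (i + 1) l
     + xcoord (i + 1) l * xcoord (i + 2) l + xcoord (i + 2) l * xcoord i l)).
  rewrite -mulrA -expRD expRN_coord; congr (_ * expR _); ring.
have [e11 e12 e21 e22] := ord3_shift k.
rewrite !sym e11 e12 e21 e22.
set p := expR _; set q := expR _.
have -> : p = q by rewrite /p /q; congr (expR (_ * _)); ring.
by rewrite subrr mulr0 mul0r.
Qed.

(** The pairwise sums of the x_i are the generalized angles, which can be
    prescribed freely among positive numbers: theta_j theta_k = e^(-l_i)
    recovers the lengths. *)
Lemma xcoord_surj (R : realType) (x y z : R) :
  0 < x + y -> 0 < x + z -> 0 < y + z ->
  exists l : 'rV[R]_3, [/\ xcoord 0 l = x, xcoord 1 l = y & xcoord 2 l = z].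
Proof.
move=> xy xz yz.
pose a := ln (y + z); pose b := ln (x + z); pose c := ln (x + y).
pose l : 'rV[R]_3 := \row_i [:: - (b + c); - (a + c); - (a + b)]`_i.
have l0 : l 0 0 = - (b + c) by rewrite mxE.
have l1 : l 0 1 = - (a + c) by rewrite mxE.
have l2 : l 0 2 = - (a + b) by rewrite mxE.
have g0 : gen_angle 0 l = y + z.
  rewrite -[RHS]lnK// /gen_angle !add0r l0 l1 l2 -/a; congr expR.
  by field.
have g1 : gen_angle 1 l = x + z.
  rewrite -[RHS]lnK// /gen_angle !ord3D l0 l1 l2 -/b; congr expR.
  by field.
have g2 : gen_angle 2 l = x + y.
  rewrite -[RHS]lnK// /gen_angle !ord3D l0 l1 l2 -/c; congr expR.
  by field.
by exists l; split; rewrite /xcoord ?(add0r, ord3D) g0 g1 g2; field.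
Qed.

(** Closedness, written in the coordinates (x_0, x_1, x_2) = (x, y, z) with z
    eliminated in favour of s = e^(-l_1) = (x + y)(y + z); then
    e^(-l_0) = (x + y)(x + z) = s + x^2 - y^2. Restricting to y <= 0 forces
    z > 0, so the factor z of the exterior derivative can be cancelled without
    a density argument. *)
Lemma closed_coord_form_functional_eq (R : realType) (A f B B' : R -> R) :
  antiderivative f A -> antiderivative B' B -> closed_form (coord_form A B) ->
  forall x y s, y <= 0 -> - y < x -> 0 < s ->
  f x * B (- ln (s + (x ^+ 2 - y ^+ 2))) = f y * B (- ln s).
Proof.
move=> dA dB cl x y s y0 yx s0.
have xy : 0 < x + y by lra.
pose z := s / (x + y) - y.
have szy : s / (x + y) = y + z by rewrite /z; ring.
have yz : 0 < y + z by rewrite -szy divr_gt0.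
have xz : 0 < x + z by lra.
have z0 : 0 < z by lra.
have sE : s = (y + z) * (x + y) by rewrite -szy divfK// gt_eqF.
have [l [x0E x1E x2E]] := xcoord_surj xy xz yz.
have l0 : l 0 0 = - ln (s + (x ^+ 2 - y ^+ 2)).
  rewrite -[LHS]opprK -[- l 0 0]expRK; congr (- ln _).
  by rewrite expRN_coord !add0r x0E x1E x2E sE; ring.
have l1 : l 0 1 = - ln s.
  rewrite -[LHS]opprK -[- l 0 1]expRK; congr (- ln _).
  by rewrite expRN_coord !ord3D x0E x1E x2E sE; ring.
(* The coefficient of dl_1 ^ dl_0 is z / 2 times the difference sought. *)
have := cl l (delta_mx 0 1) (delta_mx 0 0).
rewrite (exterior_derivative_coord_form _ _ _ dA dB) sum_ord3.
rewrite !(add0r, ord3D) x0E x1E x2E l0 l1 !mxE /=.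
rewrite !(mulr0, mul0r, mulr1, subr0, sub0r, oppr0, add0r, addr0).
move/eqP; rewrite mulf_eq0 mulf_eq0 invr_eq0 pnatr_eq0 (gt_eqF z0) /=.
by rewrite subr_eq0 => /eqP.
Qed.

(** * The functional equation *)

(** A zero propagates. If f(y) = 0 with y <= 0, then f(x) g = 0 beyond
    x^2 - y^2 for every x > - y, and if g(s) = 0, then f(x) g(s + x^2) = 0 for
    every x > 0; both contradict that, from one pair of nonzero values,
    the equation yields nonzero values of f at all large points and of g at
    arbitrarily large points. Finally f(x) = 0 with x > 0 would give
    f(0) g(s) = 0 for all s > 0. *)
Lemma gauss_functional_eq_neq0 (R : realType) (f g : R -> R) (x0 s0 : R) :
  (forall x y s, y <= 0 -> - y < x -> 0 < s ->
    f x * g (s + (x ^+ 2 - y ^+ 2)) = f y * g s) ->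
  f x0 != 0 -> 0 < s0 -> g s0 != 0 ->
  (forall x, f x != 0) /\ (forall s, 0 < s -> g s != 0).
Proof.
move=> FE fx0 s0_gt0 gs0.
have [y0 y0_le0 fy0] : exists2 y, y <= 0 & f y != 0.
  have [x0_le0|x0_gt0] := leP x0 0; first by exists x0.
  (* Some y <= 0 with y > - x0 has x0^2 - y^2 < s0: the cut-off s0/(2 x0) keeps
     x0^2 - y^2 = (x0 - y)(x0 + y) below 2 x0 (x0 + y) <= s0. *)
  pose y := Num.min 0 (s0 / (2 * x0) - x0).
  have q0 : 0 < s0 / (2 * x0) by rewrite divr_gt0 ?mulr_gt0.
  have qE : s0 / (2 * x0) * (2 * x0) = s0 by rewrite divfK// gt_eqF ?mulr_gt0.
  have y_le0 : y <= 0 by rewrite /y ge_min lexx.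
  have yx0 : - y < x0 by rewrite /y; case: (ltP 0 _) => ?; lra.
  have y_le : y <= s0 / (2 * x0) - x0 by rewrite /y ge_min lexx orbT.
  exists y => //; apply/eqP => fy.
  have [ymin|ymin] : y = 0 \/ y = s0 / (2 * x0) - x0.
  - by rewrite /y; case: (ltP 0 _) => ?; [left|right].
  - have s_gt0 : 0 < s0 - x0 ^+ 2 by move: y_le; rewrite ymin; nra.
    have := FE x0 y _ y_le0 yx0 s_gt0.
    rewrite fy mul0r ymin expr0n subr0 subrK => /eqP.
    by rewrite mulf_eq0 (negPf fx0) (negPf gs0).
  - have s_gt0 : 0 < s0 - (x0 ^+ 2 - y ^+ 2).
      by move: ymin y_le0 yx0; nra.
    have := FE x0 y _ y_le0 yx0 s_gt0.
    rewrite fy mul0r subrK => /eqP.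
    by rewrite mulf_eq0 (negPf fx0) (negPf gs0).
have far x : - y0 < x -> f x != 0 /\ g (s0 + (x ^+ 2 - y0 ^+ 2)) != 0.
  move=> yx; have := FE x y0 s0 y0_le0 yx s0_gt0.
  have: f y0 * g s0 != 0 by rewrite mulf_neq0.
  by move=> /[swap] <-; rewrite mulf_eq0 negb_or => /andP.
have farg S : exists2 s, S < s & g s != 0.
  pose x := 1 + `|S| - y0.
  have S0 : 0 <= `|S| by [].
  have SS : S <= `|S| by rewrite ler_norm.
  have [|_ gx] := far x; first by rewrite /x; lra.
  by exists (s0 + (x ^+ 2 - y0 ^+ 2)) => //; rewrite /x; nra.
have f0N y : y <= 0 -> f y != 0.
  move=> y_le0; apply/eqP => fy.
  pose x := 1 - y0 - y.
  have [|fx _] := far x; first by rewrite /x; lra.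
  have [s sx gs] := farg (x ^+ 2 - y ^+ 2).
  have yx : - y < x by rewrite /x; lra.
  have sx' : 0 < s - (x ^+ 2 - y ^+ 2) by rewrite subr_gt0.
  have := FE x y _ y_le0 yx sx'.
  rewrite fy mul0r subrK => /eqP.
  by rewrite mulf_eq0 (negPf fx) (negPf gs).
split.
  move=> x; have [|x_gt0] := leP x 0; first exact: f0N.
  apply/eqP => fx.
  have := FE x 0 s0 (lexx _); rewrite oppr0 => /(_ x_gt0 s0_gt0).
  move/esym/eqP; rewrite fx mul0r mulf_eq0 (negPf gs0) orbF.
  by apply/negP; exact: f0N.
move=> s s_gt0; apply/eqP => gs.
have [t st gt] := farg s.
pose x := Num.sqrt (t - s).
have x_gt0 : 0 < x by rewrite sqrtr_gt0 subr_gt0.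
have := FE x 0 s (lexx _); rewrite oppr0 => /(_ x_gt0 s_gt0).
rewrite gs mulr0 expr0n subr0 sqr_sqrtr ?subr_ge0 1?ltW// addrC subrK => /eqP.
rewrite mulf_eq0 (negPf gt) orbF => /eqP fx.
have := FE x 0 s0 (lexx _); rewrite oppr0 => /(_ x_gt0 s0_gt0).
move/esym/eqP; rewrite fx mul0r mulf_eq0 (negPf gs0) orbF.
by apply/negP; exact: f0N.
Qed.

(** Differentiating g(s + d) = phi(d) g(s) shows that the logarithmic
    derivative g'/g is invariant under positive shifts, hence constant. *)
Lemma multiplicative_shift_exp (R : realType) (g : R -> R) :
  (forall s : R, 0 < s -> derivable g s 1) ->
  (forall s : R, 0 < s -> g s != 0) ->
  (forall d, 0 < d -> exists phi, forall s, 0 < s -> g (s + d) = phi * g s) ->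
  exists h b : R, forall s, 0 < s -> g s = b * expR (- h * s).
Proof.
move=> dg g0 gphi.
pose k (s : R) : R := g^`()%classic s / g s.
have dg' (s : R) : 0 < s -> is_derive s 1 g (g^`()%classic s).
  by move=> s0; split; [exact: dg|rewrite derive1E].
(* Substituting s = e^t turns equations on ]0, +oo[ into equations between
   functions defined on the whole line, whose derivatives can be equated. *)
have k_shift s d : 0 < s -> 0 < d -> k (s + d) = k s.
  move=> s0 d0; have [phi phiE] := gphi _ d0.
  have EE : (fun t => g (expR t + d)) = (fun t => phi * g (expR t)).
    by apply/funext => t; rewrite phiE ?expR_gt0.
  have sd0 : 0 < s + d by rewrite addr_gt0.
  have ls : expR (ln s) = s by rewrite lnK.
  have h1 : is_derive (ln s) 1 (fun t => g (expR t + d))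
      (g^`()%classic (s + d) * s).
    apply: (@is_derive1_comp R g (fun t => expR t + d)).
      by rewrite ls; exact: dg'.
    by apply: is_derive_eq; rewrite addr0.
  have h2 : is_derive (ln s) 1 (fun t => phi * g (expR t))
      (phi * (g^`()%classic s * s)).
    have h3 : is_derive (ln s) 1 (fun t => g (expR t)) (g^`()%classic s * s).
      apply: (@is_derive1_comp R g expR); first by rewrite ls; exact: dg'.
      by apply: is_derive_eq.
    by apply: is_derive_eq.
  rewrite EE in h1.
  have := @derive_val _ _ _ _ _ _ _ h1.
  rewrite (@derive_val _ _ _ _ _ _ _ h2) mulrA => /(mulIf _) e.
  rewrite /k phiE// -e ?gt_eqF//.
  have p0 : phi != 0.
    by have := g0 _ sd0; rewrite phiE// mulf_eq0 negb_or => /andP[].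
  by field; rewrite p0 g0.
have kE s : 0 < s -> k s = k 1.
  by move=> s0; rewrite -(k_shift s 1)// addrC k_shift.
pose h := - k 1.
pose P (t : R) : R := g (expR t) * expR (h * expR t).
have dP (t : R) : is_derive t 1 P 0.
  have e0 := expR_gt0 t.
  have h3 : is_derive t 1 (fun t => g (expR t))
      (g^`()%classic (expR t) * expR t).
    apply: (@is_derive1_comp R g expR); exact: dg'.
  rewrite /P; apply: is_derive_eq.
  rewrite /h -(kE _ e0) /k /GRing.scale /=.
  by field; exact: g0.
exists h, (P 0) => s s0.
rewrite (is_derive_0_is_cst 0 (ln s) dP) /P lnK// -mulrA -expRD.
by rewrite [- h * s]mulNr subrr expR0 mulr1.
Qed.

(** With y = 0 the equation reads g(s + x^2) = (f(0) / f(x)) g(s), which makes g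
    an exponential; f is then read off from the equation, passing through the
    point 1 - x to reach negative arguments. *)
Lemma gauss_functional_eq (R : realType) (f g : R -> R) (x0 s0 : R) :
  (forall x y s, y <= 0 -> - y < x -> 0 < s ->
    f x * g (s + (x ^+ 2 - y ^+ 2)) = f y * g s) ->
  (forall s : R, 0 < s -> derivable g s 1) ->
  f x0 != 0 -> 0 < s0 -> g s0 != 0 ->
  exists h a b : R, [/\ a != 0, b != 0,
    forall x, f x = a * expR (h * x ^+ 2) &
    forall s, 0 < s -> g s = b * expR (- h * s)].
Proof.
move=> FE dg fx0 s0_gt0 gs0.
have [f0 g0] := gauss_functional_eq_neq0 FE fx0 s0_gt0 gs0.
have [h [b gE]] : exists h b : R, forall s, 0 < s -> g s = b * expR (- h * s).
  apply: multiplicative_shift_exp => // d d_gt0.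
  exists (f 0 / f (Num.sqrt d)) => s s_gt0.
  have q_gt0 : 0 < Num.sqrt d by rewrite sqrtr_gt0.
  have := FE (Num.sqrt d) 0 s (lexx _); rewrite oppr0 => /(_ q_gt0 s_gt0).
  rewrite expr0n subr0 sqr_sqrtr 1?ltW// mulrAC => <-.
  by rewrite mulrAC divff// mul1r.
have b0 : b != 0.
  by have := g0 _ s0_gt0; rewrite gE// mulf_eq0 negb_or => /andP[].
have fE x y : y <= 0 -> - y < x ->
    f x * expR (- h * x ^+ 2) = f y * expR (- h * y ^+ 2).
  move=> y_le0 yx; have := FE x y 1 y_le0 yx ltr01.
  have d_gt0 : 0 < 1 + (x ^+ 2 - y ^+ 2) by nra.
  rewrite !gE// !(mulrCA _ b) => /(mulfI b0).
  have -> : - h * (1 + (x ^+ 2 - y ^+ 2)) =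
      - h * 1 + (- h * x ^+ 2 - - h * y ^+ 2) by ring.
  rewrite !expRD mulrCA [RHS]mulrC => /(mulfI (lt0r_neq0 (expR_gt0 _))).
  move=> <-; rewrite -!mulrA -!expRD.
  by congr (_ * (expR _)); ring.
exists h, (f 0), b; split => // x.
suff : f x * expR (- h * x ^+ 2) = f 0.
  by move=> <-; rewrite -mulrA -expRD mulNr addNr expR0 mulr1.
have f00 : f 0 = f 0 * expR (- h * 0 ^+ 2) by rewrite expr0n mulr0 expR0 mulr1.
have [x_le0|x_gt0] := leP x 0; last by rewrite f00; apply: fE; rewrite ?oppr0.
rewrite -(fE (1 - x) x)//; last lra.
by rewrite f00; apply: fE; rewrite ?oppr0//; lra.
Qed.

(** * Antiderivatives and smoothness *)

Lemma ray_antiderivative (R : realType) (f : R -> R) (a : R) :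
  continuous f ->
  exists F : R -> R, forall x, a < x -> is_derive x (1 : R) F (f x).
Proof.
move=> cf.
exists (fun x => \int[lebesgue_measure]_(t in `[a, x]) f t) => x ax.
have xu : x < x + 1 by rewrite ltrDl.
have fi : lebesgue_measure.-integrable `[a, x + 1] (EFin \o f).
  apply: continuous_compact_integrable; first exact: segment_compact.
  exact: continuous_subspaceT.
have [dF F'] := continuous_FTC1_closed xu fi ax (cf x).
split; first exact: dF.
by rewrite -derive1E; exact: F'.
Qed.

(** An integral from a fixed base point is differentiable only to its right;
    reflecting the line gives a primitive to the left of 1, and the two are
    glued at 0, since their difference is constant on ]-1, 1[. *)
Lemma continuous_antiderivative (R : realType) (f : R -> R) :
  continuous f -> exists F : R -> R, antiderivative f F.
Proof.
move=> cf.
have [F dF] := ray_antiderivative (-1) cf.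
have cfN : continuous (fun x => f (- x)).
  by move=> x; apply: continuous_comp; [exact: opp_continuous|exact: cf].
have [G dG] := ray_antiderivative (-1) cfN.
have dGN (x : R) : x < 1 -> is_derive x (1 : R) (fun t => - G (- t)) (f x).
  move=> x1; have x1' : -1 < - x by rewrite ltrN2.
  have d1 := dG _ x1'.
  have d2 : is_derive x (1 : R) (fun t => - t) (-1) by exact: is_deriveNid.
  have d3 := is_derive1_comp d1 d2.
  by apply: is_derive_eq; rewrite opprK mulrN1 !opprK.
pose D (t : R) := F t + G (- t).
have D0 (t : R) : -1 < t -> t < 1 -> is_derive t (1 : R) D 0.
  move=> t1 t2; have d1 := dF t t1; have d2 := dGN t t2.
  rewrite /D (_ : (fun t => _) = F \- (fun t => - G (- t))); last first.
    by apply/funext => u /=; rewrite opprK.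
  by apply: is_derive_eq; rewrite subrr.
have Dle (s t : R) : -1 < s -> t < 1 -> s <= t -> D t = D s.
  move=> s1 t1 st; apply/eqP; rewrite -subr_eq0; apply/eqP.
  have [x||c _ ->] := @MVT_segment _ D (fun=> 0) _ _ st; last by rewrite mul0r.
  - by rewrite in_itv /= => /andP[sx xt]; apply: D0; lra.
  - apply/derivable_within_continuous => x; rewrite in_itv /= => /andP[sx xt].
    by case: (D0 x) => //; lra.
have Dc (t : R) : -1 < t -> t < 1 -> D t = D 0.
  move=> t1 t2; have [t0|/ltW t0] := leP t 0; last exact: Dle.
  by apply/esym/Dle.
pose U (t : R) := if t < 0 then - G (- t) + D 0 else F t.
exists U => t.
have [t0|t0] := ltP t 0.
  apply: (@near_eq_is_derive _ _ _ (fun t => - G (- t) + D 0)).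
  - near=> u; rewrite /U ifT//; near: u; exact: lt_nbhsl.
  - have d := dGN t (lt_trans t0 ltr01).
    by apply: is_derive_eq; rewrite addr0.
apply: (@near_eq_is_derive _ _ _ F).
- have t1 : -1 < t by lra.
  near=> u; rewrite /U; case: ifPn => // u0.
  rewrite -(Dc u) ?/D 1?addrCA ?addNr ?addr0//; last lra.
  near: u; exact: lt_nbhsr.
- by apply: dF; lra.
Unshelve. all: by end_near. Qed.

(** All orders of differentiability follow from one first-order check on a whole
    class, because the n-th derivative stays in the class. *)
Lemma smooth_family (R : realType) (C : (R -> R) -> Prop) (F : R -> R) :
  (forall f, C f -> exists2 f', C f' & antiderivative f' f) ->
  C F -> smooth F.
Proof.
move=> CC CF n.
have : C (derive1n n F).
  elim: n => [//|n /CC [f' Cf' df]].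
  rewrite derive1nS (_ : derive1 _ = f')//.
  by apply/funext => t; rewrite derive1E; exact: derive_val.
by case/CC => f' _ df t; case: (df t).
Qed.

Lemma smooth_antiderivative (R : realType) (f F : R -> R) :
  smooth f -> antiderivative f F -> smooth F.
Proof.
move=> sf dF [|n] t; first by case: (dF t).
rewrite /derive1n iterSr (_ : derive1 F = f); first exact: sf.
by apply/funext => u; rewrite derive1E; exact: derive_val.
Qed.

(** The functions p(w) E with p a polynomial are stable under differentiation
    when w' and E'/E are polynomials in w. This covers e^(h t^2), with w = t,
    and e^(- h e^(-t)), with w = e^(-t). *)
Lemma smooth_poly_exp (R : realType) (w E : R -> R) (q r : {poly R}) :
  antiderivative (fun t => q.[w t]) w ->
  antiderivative (fun t => r.[w t] * E t) E ->
  smooth E.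
Proof.
move=> dw dE.
apply: (@smooth_family _
  (fun f => exists p : {poly R}, f = fun t => p.[w t] * E t)).
  move=> _ [p ->]; exists (fun t => (p^`() * q + p * r).[w t] * E t).
    by eexists.
  move=> t; have d1 := is_derive1_comp (is_derive_poly p (w t)) (dw t).
  have d2 := dE t.
  have d3 : is_derive t (1 : R) (fun t => p.[w t] * E t)
     (p.[w t] *: (r.[w t] * E t) + E t *: (p^`().[w t] * q.[w t])).
    exact: is_deriveM.
  by apply: is_derive_eq; rewrite hornerD !hornerM /GRing.scale /=; ring.
by exists 1; apply/funext => t; rewrite hornerE mul1r.
Qed.

Lemma nonconstant_derive (R : realType) (f F : R -> R) (t : R) :
  antiderivative f F -> f t != 0 -> nonconstant F.
Proof.
move=> dF /eqP ft [c Fc]; apply: ft.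
have := @derive_val _ _ _ _ _ _ _ (dF t).
by rewrite (_ : F = cst c) ?derive_cst//; apply/funext.
Qed.

Lemma nonconstant_derive_neq0 (R : realType) (f F : R -> R) :
  antiderivative f F -> nonconstant F -> exists t, f t != 0.
Proof.
move=> dF ncF; apply: contrapT => /forallNP f0; apply: ncF.
exists (F 0) => t; apply: is_derive_0_is_cst => u.
have fu : f u = 0 by apply/eqP/negPn/negP/f0.
by have := dF u; rewrite fu.
Qed.

Lemma smooth_gauss (R : realType) (h : R) : smooth (fun t => expR (h * t ^+ 2)).
Proof.
apply: (@smooth_poly_exp _ id _ 1 ((2 * h) *: 'X)) => t.
  by rewrite hornerC; exact: is_derive_id.
rewrite hornerZ hornerX.
by apply: is_derive_eq; rewrite /GRing.scale /=; ring.
Qed.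

Lemma is_derive_expN_exp (R : realType) (h t : R) :
  is_derive t (1 : R) (fun t => expR (- h * expR (- t)))
    (h * expR (- t) * expR (- h * expR (- t))).
Proof. by apply: is_derive_eq; rewrite /GRing.scale /=; ring. Qed.

Lemma smooth_expN_exp (R : realType) (h : R) :
  smooth (fun t => expR (- h * expR (- t))).
Proof.
apply: (@smooth_poly_exp _ (fun t => expR (- t)) _ (- 'X) (h *: 'X)) => t.
  rewrite hornerN hornerX.
  by apply: is_derive_eq; rewrite /GRing.scale /=; ring.
by rewrite hornerZ hornerX; exact: is_derive_expN_exp.
Qed.

Lemma smooth_derive1 (R : realType) (f : R -> R) :
  smooth f -> antiderivative (derive1 f) f.
Proof. by move=> sf t; split; [exact: (sf 0%N)|rewrite derive1E]. Qed.

(** * Classification of the closed forms *)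

(** The functional equation applies to f = mu' and g(s) = u'(- ln s); undoing
    the substitution s = e^(-t) turns e^(- h s) into e^(- h e^(-t)). *)
Lemma derivatives_of_closed_omega (R : realType) (mu u : R -> R) :
  smooth mu -> smooth u -> nonconstant mu -> nonconstant u ->
  closed_form (omega mu u) ->
  exists h a b : R, [/\ a != 0, b != 0,
    antiderivative (fun t => a * expR (h * t ^+ 2)) mu &
    antiderivative (fun t => b * expR (- h * expR (- t))) u].
Proof.
move=> smu su nmu nu cl.
have dmu := smooth_derive1 smu; have du := smooth_derive1 su.
have ddu : antiderivative (derive1 (derive1 u)) (derive1 u).
  by move=> t; split; [exact: (su 1%N)|rewrite [RHS]derive1E].
have [x0 fx0] := nonconstant_derive_neq0 dmu nmu.
have [t0 gt0] := nonconstant_derive_neq0 du nu.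
have {}cl : closed_form (coord_form mu (derive1 u)).
  rewrite (_ : coord_form _ _ = omega mu u)//.
  by apply/funext => l; apply/funext => v; rewrite (omegaE _ _ _ du).
pose g (s : R) : R := derive1 u (- ln s).
have dg (s : R) : 0 < s -> derivable g s 1.
  move=> s0; have d1 := is_derive1_ln s0.
  have d2 : is_derive s 1 (fun s => - ln s) (- s^-1) by apply: is_deriveN.
  by case: (@is_derive1_comp R u^`()%classic (fun s => - ln s) s _ _
    (ddu _) d2).
have gs0 : g (expR (- t0)) != 0 by rewrite /g expRK opprK.
have [h [a [b [a0 b0 fE gE]]]] :=
  gauss_functional_eq (closed_coord_form_functional_eq dmu ddu cl) dg fx0
    (expR_gt0 _) gs0.
exists h, a, b; split => // t; first by rewrite -fE; exact: dmu.
rewrite -gE ?expR_gt0// /g expRK opprK; exact: du.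
Qed.

Theorem theorem5p1 (R : realType) :
  (forall mu u : R -> R,
     smooth mu -> smooth u -> nonconstant mu -> nonconstant u ->
     (closed_form (omega mu u) <->
      exists (h c : R) (M : R -> R),
        [/\ c != 0,
            antiderivative (fun t => expR (h * t ^+ 2)) M &
            forall l v : 'rV[R]_3, omega mu u l v = c * omega_h h M l v])) /\
  (forall (h : R) (M : R -> R),
     antiderivative (fun t => expR (h * t ^+ 2)) M ->
     exists U : R -> R,
       [/\ antiderivative (fun t => expR (- h * expR (- t))) U,
           smooth M /\ nonconstant M,
           smooth U /\ nonconstant U &
           forall l v : 'rV[R]_3, omega M U l v = omega_h h M l v]).
Proof.
split=> [mu u smu su nmu nu|h M dM].
  split=> [/(derivatives_of_closed_omega smu su nmu nu)|].
    move=> [h [a [b [a0 b0 dmu du]]]].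
    (* Scaling mu so that its derivative is exactly e^(h t^2) puts all the scale
       into the constant a b. *)
    exists h, (a * b), (fun t => a^-1 * mu t); split.
    - by rewrite mulf_neq0.
    - move=> t; have d := dmu t.
      by apply: is_derive_eq; rewrite /GRing.scale /= mulrA mulVf ?mul1r.
    - move=> l v; rewrite (omegaE _ _ _ du) omega_hE mulr_sumr.
      by apply: eq_bigr => i _; field.
  move=> [h [c [M [_ dM E]]]].
  rewrite (_ : omega mu u =
    coord_form (fun t => c * M t) (fun t => expR (- h * expR (- t)))).
    apply: (@closed_coord_form_gauss _ h c) => t; have d := dM t.
    by apply: is_derive_eq.
  apply/funext => l; apply/funext => v; rewrite E omega_hE mulr_sumr.
  by apply: eq_bigr => i _; rewrite !mulrA.
have ce : continuous (fun t : R => expR (- h * expR (- t))).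
  move=> t; apply/differentiable_continuous/derivable1_diffP.
  by case: (is_derive_expN_exp h t).
have [U dU] := continuous_antiderivative ce.
exists U; split; first exact: dU.
- split; first exact (@smooth_antiderivative _ _ _ (@smooth_gauss R h) dM).
  by apply: (nonconstant_derive dM (t := 0)); rewrite gt_eqF ?expR_gt0.
- split; first exact (@smooth_antiderivative _ _ _ (@smooth_expN_exp R h) dU).
  by apply: (nonconstant_derive dU (t := 0)); rewrite gt_eqF ?expR_gt0.
- by move=> l v; rewrite (omegaE _ _ _ dU) omega_hE.
Qed.
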